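(* Let $x^\circ$ be a feasible solution for $\mathcal{IP}$. Then $$\mathit{IFR}(\mathcal{LP},x^\circ)=\Big\{ d\in\bigcup_{B\in\mathcal{B}}\mathit{IFR}(\mathcal{G}^B,x^\circ)\ \Big|\ \bar d_N^{\intercal}x^\circ_N=0\Big\},$$ where the condition on the right refers to the basis through which $d$ belongs to the union; that is, $d\in\mathit{IFR}(\mathcal{LP},x^\circ)$ if and only if there exists $B\in\mathcal{B}$, with $N=\{1,\dots,n\}\setminus B$, such that $d\in\mathit{IFR}(\mathcal{G}^B,x^\circ)$ and $\bar d_N^{\intercal}x^\circ_N=0$.
   Context: Let $m\le n$, let $A\in\mathbb{Z}^{m\times n}$ have full row rank, and let $b\in\mathbb{Z}^m$, $c\in\mathbb{R}^n$. The integer program $\mathcal{IP}$ is $\min\{c^\intercal x\mid Ax=b,\ x\ge\mathbf{0},\ x\in\mathbb{Z}^n\}$, assumed to have nonempty feasible region; its LP relaxation $\mathcal{LP}$ is $\min\{c^\intercal x\mid Ax=b,\ x\ge\mathbf{0},\ x\in\mathbb{R}^n\}$. A basis is a set $B\subseteq\{1,\dots,n\}$ with $|B|=m$ such that the submatrix $A_B$ of columns indexed by $B$ is nonsingular; $N=\{1,\dots,n\}\setminus B$, $A_N$ is the submatrix of columns indexed by $N$, and for a vector $v\in\mathbb{R}^n$, $v_B,v_N$ are its subvectors indexed by $B,N$. The basis $B$ is feasible for $\mathcal{LP}$ if $A_B^{-1}b\ge\mathbf{0}$. $\mathcal{B}$ denotes the finite set of all feasible bases of $\mathcal{LP}$.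 The Gomory corner relaxation $\mathcal{G}^B$ of $\mathcal{IP}$ with respect to $B$ is $\min\{c_B^\intercal x_B+c_N^\intercal x_N\mid A_Bx_B+A_Nx_N=b,\ x_N\ge\mathbf{0},\ x\in\mathbb{Z}^n\}$ (the nonnegativity of $x_B$ is dropped). For $d\in\mathbb{R}^n$, $\bar d_N:=(d_N^\intercal-d_B^\intercal A_B^{-1}A_N)^\intercal$ is the vector of reduced costs with respect to $B$. For $\mathcal{P}\in\{\mathcal{IP},\mathcal{LP},\mathcal{G}^B\}$, $\mathcal{P}^d$ is the problem $\mathcal{P}$ with objective vector $c$ replaced by $d$. For a feasible solution $x^\circ$ of $\mathcal{P}$, the inverse-feasible region $\mathit{IFR}(\mathcal{P},x^\circ)$ is the set of all $d\in\mathbb{R}^n$ such that $x^\circ$ is an optimal solution for $\mathcal{P}^d$. *)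

(* Defs.v *)
From mathcomp Require Import all_boot all_order all_algebra.
From mathcomp Require Import classical_sets reals.

Set Implicit Arguments.
Unset Strict Implicit.
Unset Printing Implicit Defensive.

Import Order.TTheory GRing.Theory Num.Theory.
Local Open Scope classical_set_scope.
Local Open Scope ring_scope.

Record program (R : realType) (n : nat) := Program {
  objective : 'cV[R]_n -> R;
  feasible : set 'cV[R]_n }.

Definition optimal (R : realType) (n : nat) (P : program R n) (x : 'cV[R]_n) :=
  feasible P x /\ forall y, feasible P y -> objective P x <= objective P y.

(* A problem whose cost vector may vary is given as a family, P d being the
   problem with cost vector d. *)
Definition IFR (R : realType) (n : nat) (P : 'cV[R]_n -> program R n)
    (x : 'cV[R]_n) : set 'cV[R]_n :=
  [set d | optimal (P d) x].

Definition dot (R : realType) (n : nat) (u v : 'cV[R]_n) : R :=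
  (u^T *m v) ord0 ord0.

Definition nonneg (R : realType) (n : nat) (x : 'cV[R]_n) : Prop :=
  forall i, 0 <= x i ord0.

Definition LP (R : realType) (m n : nat) (A : 'M[int]_(m, n)) (b : 'cV[int]_m)
    (c : 'cV[R]_n) : program R n :=
  {| objective := fun x => dot c x;
     feasible := [set x | map_mx intr A *m x = map_mx intr b /\ nonneg x] |}.

Definition IP (R : realType) (m n : nat) (A : 'M[int]_(m, n)) (b : 'cV[int]_m)
    (c : 'cV[R]_n) : program R n :=
  {| objective := fun x => dot c x;
     feasible := [set x | [/\ map_mx intr A *m x = map_mx intr b, nonneg x
                            & x \is a mxOver Num.int]] |}.

(* The increasing enumeration of a set of k indices. *)
Definition idx (n k : nat) (S : {set 'I_n}) (cardS : #|S| = k) (i : 'I_k) : 'I_n :=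
  enum_val (cast_ord (esym cardS) i).

(* Nonsingularity is over the rationals: an integer matrix belongs to unitmx
   only if it is unimodular. *)
Record basis (m n : nat) (A : 'M[int]_(m, n)) := Basis {
  basic_set :> {set 'I_n};
  card_basic_set : #|basic_set| = m;
  basis_nonsingular : \det (colsub (idx card_basic_set) A) != 0 }.

Definition basic_mx (R : realType) (m n : nat) (A : 'M[int]_(m, n))
    (B : basis A) : 'M[R]_m :=
  map_mx intr (colsub (idx (card_basic_set B)) A).

Definition nonbasic_mx (R : realType) (m n : nat) (A : 'M[int]_(m, n))
    (B : basis A) : 'M[R]_(m, #|~: B|) :=
  map_mx intr (colsub (idx (erefl #|~: B|)) A).

Definition basic_part (R : realType) (m n : nat) (A : 'M[int]_(m, n))
    (B : basis A) (v : 'cV[R]_n) : 'cV[R]_m :=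
  rowsub (idx (card_basic_set B)) v.

Definition nonbasic_part (R : realType) (m n : nat) (A : 'M[int]_(m, n))
    (B : basis A) (v : 'cV[R]_n) : 'cV[R]_#|~: B| :=
  rowsub (idx (erefl #|~: B|)) v.

Definition feasible_basis (R : realType) (m n : nat) (A : 'M[int]_(m, n))
    (B : basis A) (b : 'cV[int]_m) : Prop :=
  nonneg (invmx (basic_mx R B) *m map_mx intr b).

Definition reduced_costs (R : realType) (m n : nat) (A : 'M[int]_(m, n))
    (B : basis A) (d : 'cV[R]_n) : 'cV[R]_#|~: B| :=
  ((nonbasic_part B d)^T
   - (basic_part B d)^T *m invmx (basic_mx R B) *m nonbasic_mx R B)^T.

(* The Gomory corner relaxation: nonnegativity of the basic part is dropped. *)
Definition corner (R : realType) (m n : nat) (A : 'M[int]_(m, n))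
    (B : basis A) (b : 'cV[int]_m) (c : 'cV[R]_n) : program R n :=
  {| objective := fun x => dot (basic_part B c) (basic_part B x)
                           + dot (nonbasic_part B c) (nonbasic_part B x);
     feasible := [set x |
       [/\ basic_mx R B *m basic_part B x + nonbasic_mx R B *m nonbasic_part B x
             = map_mx intr b,
           nonneg (nonbasic_part B x) & x \is a mxOver Num.int]] |}.

(* Main.v *)
Require Import Defs.
From mathcomp Require Import all_boot all_order all_algebra.
From mathcomp Require Import boolp classical_sets reals.
From mathcomp Require Import ring.

Import Order.TTheory GRing.Theory Num.Theory.
Local Open Scope classical_set_scope.
Local Open Scope ring_scope.

(** Fix a basis B. On the solutions of A x = b the cost d^T x is a constant
plus the reduced costs applied to x_N ([dot_reduced_costs]), and the constant
is the cost of the basic solution of B. Everything follows from this identity,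
once each side of the equality is related to the sign of the reduced costs.

If x0 solves the corner relaxation for d, the reduced costs are nonnegative:
the edge direction of the LP at B attached to a nonbasic index k becomes
integral after scaling by a power of det A_B, so x0 can be moved along it inside
the corner relaxation, and the cost then varies by a positive multiple of the
k-th reduced cost ([corner_reduced_costs_ge0]). With x0_N orthogonal to the
reduced costs, x0 attains the constant, which is a lower bound for the LP.

Conversely, let x0 solve the LP for d. What is needed is one basis that is both
primal feasible and of nonnegative reduced costs, in spite of possible
degeneracy ([IFR_LP_optimal_basis]). No pivoting is used. Farkas' lemma gives
a dual solution y complementary to x0; among these choose one whose set J of
tight dual constraints is maximal, so that the columns of A indexed by J span
([spanning_dual_certificate], where full row rank is used). Independently,
shrink the support of x0 to obtain a basic feasible solution x' supported on a
set S of independent columns inside the support of x0, hence inside J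
([basic_feasible_solution]). Any maximal independent B with S included in B and
B included in J is a basis ([basis_extension]); it is primal feasible because
x' is its basic solution, and its reduced costs are the slacks of y, hence
nonnegative and complementary to x0. *)

(** * Farkas' lemma and the ratio test *)

(** Either g is a conic combination of the rows of M, or some x separates it
from them. The proof is by induction on the number of rows. *)
Lemma farkas {F : realFieldType} {n k : nat} (M : 'M[F]_(k, n)) (g : 'rV[F]_n) :
  (exists2 l : 'rV[F]_k, (forall i, 0 <= l 0 i) & g = l *m M) \/
  (exists2 x : 'cV[F]_n, (forall i, 0 <= (M *m x) i 0) & (g *m x) 0 0 < 0).
Proof.
elim: k M g => [|k IHk] M g.
  have [->|g_neq0] := eqVneq g 0.
    by left; exists 0 => [[]|] //; rewrite mul0mx.
  right; exists (- g^T) => [[]|] //.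
  rewrite mulmxN mxE oppr_lt0 mxE lt_neqAle eq_sym psumr_eq0; last first.
    by move=> i _; rewrite mxE -expr2 sqr_ge0.
  rewrite sumr_ge0 ?andbT => [|i _]; last by rewrite mxE -expr2 sqr_ge0.
  apply: contra g_neq0 => /allP g0; apply/eqP/rowP => i; rewrite mxE.
  have /(_ (mem_index_enum i)) := g0 i.
  by rewrite mxE mulf_eq0 orbb => /eqP.
rewrite -[k.+1]/(1 + k)%N in M *.
rewrite -[M]vsubmxK; set a := usubmx M; set D := dsubmx M.
case: (IHk D g) => [[l l_ge0 ->]|[x Dx_ge0 gx_lt0]].
  left; exists (row_mx 0 l); last by rewrite mul_row_col mul0mx add0r.
  by move=> i; rewrite mxE; case: split => j //; rewrite mxE.
have [ax_ge0|ax_lt0] := leP 0 ((a *m x) 0 0).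
  right; exists x => // i; rewrite mul_col_mx mxE; case: split => j //.
  by rewrite ord1.
set t := (a *m x) 0 0 in ax_lt0; have t_neq0 : t != 0 by rewrite lt_eqF.
(* Project the rows along a onto those that annihilate x; by projE this is dual
   to projecting vectors along x onto the kernel of a. *)
pose proj p (E : 'M[F]_(p, n)) := E - t^-1 *: (E *m x *m a).
have projE p (E : 'M[F]_(p, n)) x' :
    proj p E *m x' = E *m (x' - (t^-1 * (a *m x') 0 0) *: x).
  rewrite /proj mulmxBl mulmxBr -scalemxAl -scalemxAr -[E *m x *m a *m x']mulmxA.
  by rewrite {1}[a *m x']mx11_scalar mul_mx_scalar scalerA.
case: (IHk (proj _ D) (proj _ g)) => [[l l_ge0 gE]|[x' Dx_ge0' gx_lt0']].
  left; exists (row_mx (t^-1 *: (g *m x - l *m (D *m x))) l).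
    move=> i; rewrite mxE; case: split => j //; rewrite ord1.
    have lDx_ge0 : 0 <= (l *m (D *m x)) 0 0.
      by rewrite mxE; apply: sumr_ge0 => p _; apply: mulr_ge0.
    move: (l *m (D *m x)) (g *m x) gx_lt0 lDx_ge0 => u v v_lt0 u_ge0.
    rewrite !mxE; apply: mulr_le0; first by rewrite invr_le0 ltW.
    by rewrite subr_le0 (le_trans (ltW v_lt0)).
  rewrite mul_row_col -scalemxAl mulmxBl.
  move/eqP: gE; rewrite /proj subr_eq mulmxBr -scalemxAr !mulmxA => /eqP gE.
  by rewrite {1}gE scalerBr [LHS]addrC [LHS]addrA [LHS]addrAC.
right; rewrite projE in gx_lt0'; rewrite projE in Dx_ge0'.
exists (x' - (t^-1 * (a *m x') 0 0) *: x) => // i.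
rewrite mul_col_mx mxE; case: split => j //.
rewrite ord1 mulmxBr -scalemxAr [a *m x]mx11_scalar scale_scalar_mx -/t.
by rewrite mulrAC mulVf // mul1r -mx11_scalar subrr mxE.
Qed.

(** Moving from a nonnegative u along a nonzero line, with t of either sign, one
can reach a point that is still nonnegative and where a coordinate that moves
has become zero. *)
Lemma ratio_test {F : realFieldType} {n : nat} {u h : 'cV[F]_n} :
  (forall j, 0 <= u j 0) -> h != 0 ->
  exists t i, [/\ h i 0 != 0, (u - t *: h) i 0 = 0
                & forall j, 0 <= (u - t *: h) j 0].
Proof.
move=> u_ge0.
suff pos (h' : 'cV[F]_n) (k : 'I_n) : 0 < h' k 0 ->
    exists t i, [/\ h' i 0 != 0, (u - t *: h') i 0 = 0
                  & forall j, 0 <= (u - t *: h') j 0].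
  case/cV0Pn=> k; rewrite neq_lt => /orP[hk_lt0|]; last exact: pos.
  have [|t [i [hi_neq0 ui0 uh_ge0]]] := pos (- h) k.
    by rewrite mxE oppr_gt0.
  rewrite mxE oppr_eq0 in hi_neq0.
  by exists (- t), i; rewrite scaleNr -scalerN.
move=> hk_gt0.
case: (@Order.TotalTheory.arg_minP _ _ _ k (fun i => 0 < h' i 0)
         (fun i => u i 0 / h' i 0)) => // i hi_gt0 i_min.
exists (u i 0 / h' i 0), i; split=> [||j]; rewrite ?gt_eqF // !mxE.
  by rewrite divfK ?subrr ?gt_eqF.
rewrite subr_ge0; have [hj_gt0|hj_le0] := ltP 0 (h' j 0).
  by rewrite -ler_pdivlMr // i_min.
apply: le_trans (u_ge0 j); apply: mulr_ge0_le0 => //.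
by rewrite divr_ge0 // ltW.
Qed.

(** * Bases as independent spanning sets of columns *)

(** The columns of A indexed by S are linearly independent: a vector h supported
on S with A h = 0 vanishes. *)
Definition independent {F : fieldType} {m n : nat} (A : 'M[F]_(m, n))
    (S : {set 'I_n}) : Prop :=
  forall h : 'cV[F]_n,
    (forall j, j \notin S -> h j 0 = 0) -> A *m h = 0 -> h = 0.

(** The columns of A indexed by J span the whole space, stated dually: only the
zero vector is orthogonal to all of them. *)
Definition spanning {F : fieldType} {m n : nat} (A : 'M[F]_(m, n))
    (J : {set 'I_n}) : Prop :=
  forall z : 'cV[F]_m, (forall j, j \in J -> (A^T *m z) j 0 = 0) -> z = 0.

(** A support of a nonnegative solution that is minimal for inclusion indexes
independent columns: otherwise the ratio test along a linear dependency would
shrink it. *)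
Lemma basic_feasible_solution {F : realFieldType} {m n : nat}
    (A : 'M[F]_(m, n)) {x : 'cV[F]_n} :
  (forall j, 0 <= x j 0) ->
  exists (S : {set 'I_n}) (x' : 'cV[F]_n),
    [/\ S \subset [set j | x j 0 != 0]%SET, independent A S,
        (forall j, 0 <= x' j 0), A *m x' = A *m x
      & forall j, j \notin S -> x' j 0 = 0].
Proof.
move=> x_ge0.
pose supports (S : {set 'I_n}) := `[< exists x' : 'cV[F]_n,
  [/\ forall j, 0 <= x' j 0, A *m x' = A *m x
    & forall j, j \notin S -> x' j 0 = 0] >].
have /minset_exists[S /minsetP[/asboolP[x' [x'_ge0 Ax' x'0]] S_min] sub_S] :
    supports [set j | x j 0 != 0]%SET.
  by apply/asboolP; exists x; split=> // j; rewrite inE negbK => /eqP.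
exists S, x'; split=> // h h0 Ah; apply/eqP/contraT=> h_neq0.
have [t [i [hi_neq0 x'i0 x'h_ge0]]] := ratio_test x'_ge0 h_neq0.
have iS : i \in S by apply: contraR hi_neq0 => /h0->.
suff : i \in S :\ i by rewrite !inE eqxx.
rewrite (S_min (S :\ i)) ?subD1set //; apply/asboolP; exists (x' - t *: h); split=> //.
  by rewrite mulmxBr -scalemxAr Ah scaler0 subr0.
move=> j; rewrite !inE negb_and negbK => /orP[/eqP-> //|jS].
by rewrite !mxE x'0 // h0 // mulr0 subr0.
Qed.

(** A maximal independent B between S and J spans, since each column in J is a
combination of the columns in B. *)
Lemma basis_extension {F : fieldType} {m n : nat} {A : 'M[F]_(m, n)}
    {S J : {set 'I_n}} :
  independent A S -> S \subset J -> spanning A J ->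
  exists B : {set 'I_n}, [/\ S \subset B, B \subset J, independent A B & spanning A B].
Proof.
move=> indS sSJ spanJ.
pose P (B : {set 'I_n}) := `[< independent A B >] && (B \subset J).
have /maxset_exists[B /maxsetP[/andP[/asboolP indB sBJ] B_max] sSB] : P S.
  by rewrite /P sSJ andbT; apply/asboolP.
exists B; split=> // z z0; apply: spanJ => j jJ.
have [/z0 //|jB] := boolP (j \in B).
have /existsNP[h /not_implyP[h0 /not_implyP[Ah /eqP h_neq0]]] :
    ~ independent A (j |: B).
  move=> ind_jB; have: j \in B; last by rewrite (negPf jB).
  rewrite -(B_max (j |: B)) ?finset.setU11 ?finset.subsetUr //.
  by rewrite /P finset.subUset finset.sub1set jJ sBJ !andbT; apply/asboolP.
have hj_neq0 : h j 0 != 0.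
  apply: contra h_neq0 => /eqP hj0; apply/eqP/indB => // k kB.
  have [-> //|kj] := eqVneq k j; apply: h0.
  by rewrite !inE negb_or kj.
have: (h^T *m (A^T *m z)) 0 0 = 0.
  by rewrite mulmxA -trmx_mul Ah trmx0 mul0mx mxE.
rewrite mxE (bigD1 j) //= big1 ?addr0 => [|k kj].
  by rewrite mxE => /eqP; rewrite mulf_eq0 (negPf hj_neq0) => /eqP.
have [kB|kB] := boolP (k \in B); first by rewrite z0 ?mulr0.
by rewrite mxE h0 ?mul0r // !inE negb_or kj.
Qed.

(** * Submatrices of columns and their rank *)

Lemma sum_idx {V : nmodType} {n k : nat} {S : {set 'I_n}} (cardS : #|S| = k)
    (f : 'I_n -> V) :
  \sum_(i < k) f (idx cardS i) = \sum_(j in S) f j.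
Proof.
case: k / cardS; rewrite [RHS]big_enum_val; apply: eq_bigr => i _.
by rewrite /idx cast_ord_id.
Qed.

Lemma idx_in {n k : nat} {S : {set 'I_n}} (cardS : #|S| = k) (i : 'I_k) :
  idx cardS i \in S.
Proof. exact: enum_valP. Qed.

Lemma idx_onto {n k : nat} {S : {set 'I_n}} (cardS : #|S| = k) (j : 'I_n) :
  j \in S -> exists i, j = idx cardS i.
Proof.
move=> jS; exists (cast_ord cardS (enum_rank_in jS j)).
by rewrite /idx cast_ord_comp cast_ord_id enum_rankK_in.
Qed.

Lemma idx_inj {n k : nat} {S : {set 'I_n}} (cardS : #|S| = k) :
  injective (idx cardS).
Proof. by move=> i j /enum_val_inj/cast_ord_inj. Qed.

Lemma mulmx_colsub_idx {R : pzRingType} {m n k : nat} (A : 'M[R]_(m, n))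
    {S : {set 'I_n}} (cardS : #|S| = k) (x : 'cV[R]_n) :
  (forall j, j \notin S -> x j 0 = 0) ->
  colsub (idx cardS) A *m rowsub (idx cardS) x = A *m x.
Proof.
move=> x0; apply/matrixP => i l; rewrite !mxE ord1.
rewrite [RHS](bigID (mem S)) /= [X in _ + X]big1 ?addr0.
  by rewrite -(sum_idx cardS); apply: eq_bigr => j _; rewrite !mxE.
by move=> j /x0->; rewrite mulr0.
Qed.

Lemma independent_rank {F : fieldType} {m n k : nat} {A : 'M[F]_(m, n)}
    {S : {set 'I_n}} (cardS : #|S| = k) :
  independent A S -> \rank (colsub (idx cardS) A) = k.
Proof.
move=> indS; rewrite -mxrank_tr; apply/eqP; rewrite -/(row_free _) -kermx_eq0.
apply/rowV0P => v /sub_kermxP vA0.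
pose h : 'cV[F]_n := \col_j \sum_(i < k | idx cardS i == j) v 0 i.
have hE i : h (idx cardS i) 0 = v 0 i.
  rewrite mxE (big_pred1 i) // => i'.
  exact: inj_eq (@idx_inj _ _ _ cardS) _ _.
have h_off j : j \notin S -> h j 0 = 0.
  move=> jS; rewrite mxE big1 // => i /eqP iE.
  by rewrite -iE idx_in in jS.
have vE : rowsub (idx cardS) h = v^T.
  by apply/colP => i; rewrite !mxE -hE mxE.
have h0 : h = 0.
  apply: indS => //; rewrite -(mulmx_colsub_idx _ cardS _ h_off) vE.
  by apply: trmx_inj; rewrite trmx_mul trmxK vA0 trmx0.
by apply/rowP => i; rewrite -hE h0 !mxE.
Qed.

Lemma spanning_rank {F : fieldType} {m n k : nat} {A : 'M[F]_(m, n)}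
    {S : {set 'I_n}} (cardS : #|S| = k) :
  spanning A S -> \rank (colsub (idx cardS) A) = m.
Proof.
move=> spanS; apply/eqP; rewrite -/(row_free _) -kermx_eq0.
apply/rowV0P => v /sub_kermxP vA0; apply: trmx_inj; rewrite trmx0.
apply: spanS => j /(idx_onto cardS)[i ->].
have /rowP/(_ i) := vA0; rewrite !mxE; apply: etrans.
by apply: eq_bigr => l _; rewrite !mxE mulrC.
Qed.

(** * Duality in linear programming *)

Lemma feasible_step {F : realFieldType} {n : nat} {x h : 'cV[F]_n} :
  (forall j, 0 <= x j 0) -> (forall j, x j 0 = 0 -> 0 <= h j 0) ->
  exists2 e, 0 < e & forall j, 0 <= (x + e *: h) j 0.
Proof.
move=> x_ge0 h_ge0.
pose r j := if h j 0 < 0 then x j 0 / - h j 0 else 1.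
have r_gt0 j : 0 < r j.
  rewrite /r; case: (ltP (h j 0) 0) => // hj_lt0.
  rewrite divr_gt0 ?oppr_gt0 // lt_neqAle x_ge0 andbT eq_sym.
  by apply: contraTneq hj_lt0 => /h_ge0; rewrite -leNgt.
pose e := \big[Num.min/1]_j r j.
have e_gt0 : 0 < e by apply: lt_bigmin.
have e_le j : e <= r j by exact: bigmin_le.
exists e => // j; rewrite !mxE.
have [hj_lt0|hj_ge0] := ltP (h j 0) 0; last first.
  by rewrite addr_ge0 // mulr_ge0 // ltW.
have := e_le j; rewrite /r hj_lt0 ler_pdivlMr ?oppr_gt0 //.
by rewrite mulrN -subr_ge0 opprK.
Qed.

(** The slacks of y in the dual constraints A^T y <= d. *)
Definition dual_slack {F : fieldType} {m n : nat} (A : 'M[F]_(m, n))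
    (d : 'cV[F]_n) (y : 'cV[F]_m) : 'cV[F]_n :=
  d - A^T *m y.

(** y is dual feasible and satisfies complementary slackness with x. *)
Definition dual_certificate {F : realFieldType} {m n : nat}
    (A : 'M[F]_(m, n)) (d x : 'cV[F]_n) (y : 'cV[F]_m) : Prop :=
  (forall j, 0 <= dual_slack A d y j 0) /\
  (forall j, x j 0 != 0 -> dual_slack A d y j 0 = 0).

(** Farkas' lemma is applied to d and the constraints of the cone of feasible
directions at x, which are A h = 0 and h_j >= 0 whenever x_j = 0: a separating
h would be an improving direction, and a conic combination is a certificate. *)
Lemma optimal_dual_certificate {F : realFieldType} {m n : nat}
    {A : 'M[F]_(m, n)} {d x : 'cV[F]_n} :
  (forall j, 0 <= x j 0) ->
  (forall x' : 'cV[F]_n, (forall j, 0 <= x' j 0) -> A *m x' = A *m x ->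
     (d^T *m x) 0 0 <= (d^T *m x') 0 0) ->
  exists y, dual_certificate A d x y.
Proof.
move=> x_ge0 x_opt.
(* z marks the coordinates where x vanishes, which must not decrease. *)
pose z : 'rV[F]_n := \row_j (x j 0 == 0)%:R.
case: (farkas (col_mx A (col_mx (- A) (diag_mx z))) d^T).
  case=> l l_ge0; rewrite -[l]hsubmxK; set l1 := lsubmx l.
  rewrite -[rsubmx l]hsubmxK; set l2 := lsubmx _; set l3 := rsubmx _.
  rewrite !mul_row_col mulmxN => dE; exists (l1 - l2)^T.
  have sE j : dual_slack A d (l1 - l2)^T j 0 = l3 0 j * z 0 j.
    rewrite /dual_slack -trmx_mul -[d]trmxK dE mulmxBl.
    rewrite addrA [_ + _ *m diag_mx z]addrC linearD addrK mxE.
    by rewrite mul_mx_diag mxE.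
  split=> j; rewrite sE [z 0 j]mxE; last by move/negPf->; rewrite mulr0.
  by rewrite mulr_ge0 ?ler0n // !mxE.
case=> h; rewrite !mul_col_mx mulNmx => Mh_ge0 dh_lt0.
have Ah0 : A *m h = 0.
  apply/colP => i; rewrite [RHS]mxE; apply/le_anti/andP; split.
    have := Mh_ge0 (rshift _ (lshift _ i)).
    by rewrite col_mxEd col_mxEu mxE oppr_ge0.
  by have := Mh_ge0 (lshift _ i); rewrite col_mxEu.
have h_ge0 j : x j 0 = 0 -> 0 <= h j 0.
  move=> xj0; have := Mh_ge0 (rshift _ (rshift _ j)).
  by rewrite !col_mxEd mul_diag_mx !mxE xj0 eqxx mul1r.
have [e e_gt0 xh_ge0] := feasible_step x_ge0 h_ge0.
have := x_opt _ xh_ge0; rewrite !mulmxDr -!scalemxAr Ah0 scaler0 addr0.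
move=> /(_ erefl); rewrite [leRHS]mxE lerDl [leRHS]mxE pmulr_rge0 // => dh_ge0.
by have := lt_le_trans dh_lt0 dh_ge0; rewrite ltxx.
Qed.

(** If the tight columns do not span, moving y along a vector orthogonal to all
of them keeps these constraints tight, and the ratio test makes another one
tight. *)
Lemma spanning_dual_certificate {F : realFieldType} {m n : nat}
    {A : 'M[F]_(m, n)} {d x : 'cV[F]_n} :
  \rank A = m -> (exists y, dual_certificate A d x y) ->
  exists2 y, dual_certificate A d x y
    & spanning A [set j | dual_slack A d y j 0 == 0]%SET.
Proof.
move=> rankA [y0 [s0_ge0 s0_x]].
pose tight (J : {set 'I_n}) := `[< exists2 y, dual_certificate A d x y
  & forall j, j \in J -> dual_slack A d y j 0 = 0 >].
have /maxset_exists[J /maxsetP[/asboolP[y [s_ge0 s_x] sJ] J_max] _] :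
    tight finset.set0.
  by apply/asboolP; exists y0 => // j; rewrite inE.
exists y => // z z0.
suff Az0 : A^T *m z = 0.
  have /row_freeP[C AC1] : row_free A by rewrite /row_free rankA.
  by rewrite -[z]mul1mx -trmx1 -AC1 trmx_mul -mulmxA Az0 mulmx0.
apply/eqP/contraT=> h_neq0.
have [t [i [hi_neq0 si0 sh_ge0]]] := ratio_test s_ge0 h_neq0.
have sE : dual_slack A d (y + t *: z) = dual_slack A d y - t *: (A^T *m z).
  by rewrite /dual_slack mulmxDr -scalemxAr opprD addrA.
have s_tight j : dual_slack A d y j 0 = 0 -> dual_slack A d (y + t *: z) j 0 = 0.
  by move=> sj0; rewrite sE mxE sj0 add0r mxE mxE z0 ?mulr0 ?oppr0 // inE sj0.
have /asboolP : tight (i |: J).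
  apply/asboolP; exists (y + t *: z).
    by split=> [j|j /s_x/s_tight //]; rewrite sE.
  by move=> j; rewrite !inE => /orP[/eqP->|/sJ/s_tight //]; rewrite sE.
move=> /asboolP/J_max/(_ (finset.subsetUr _ _)) JE.
have iJ : i \in J by rewrite -JE finset.setU11.
by rewrite z0 ?eqxx // inE sJ in hi_neq0.
Qed.

(** An optimal solution x yields an independent spanning set B of columns that
carries a feasible solution x' and on which a dual certificate for x is tight. *)
Lemma optimal_basic_set {F : realFieldType} {m n : nat}
    {A : 'M[F]_(m, n)} {d x : 'cV[F]_n} :
  \rank A = m -> (forall j, 0 <= x j 0) ->
  (forall x' : 'cV[F]_n, (forall j, 0 <= x' j 0) -> A *m x' = A *m x ->
     (d^T *m x) 0 0 <= (d^T *m x') 0 0) ->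
  exists (B : {set 'I_n}) (x' : 'cV[F]_n) (y : 'cV[F]_m),
    [/\ independent A B /\ spanning A B,
        [/\ (forall j, 0 <= x' j 0), A *m x' = A *m x
          & forall j, j \notin B -> x' j 0 = 0],
        dual_certificate A d x y
      & forall j, j \in B -> dual_slack A d y j 0 = 0].
Proof.
move=> rankA x_ge0 x_opt.
have [y [s_ge0 s_x] spanJ] :=
  spanning_dual_certificate rankA (optimal_dual_certificate x_ge0 x_opt).
have [S [x' [sSx indS x'_ge0 Ax' x'0]]] := basic_feasible_solution A x_ge0.
have sSJ : S \subset [set j | dual_slack A d y j 0 == 0]%SET.
  apply/fintype.subsetP => j /(fintype.subsetP sSx); rewrite !inE => /s_x->.
  exact: eqxx.
have [B [sSB sBJ indB spanB]] := basis_extension indS sSJ spanJ.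
exists B, x', y; split=> // [|j jB].
  by split=> // j jB; apply: x'0; apply: contra jB => /(fintype.subsetP sSB).
by have := fintype.subsetP sBJ _ jB; rewrite inE => /eqP.
Qed.

(** * Reduced costs and the corner relaxation *)

Lemma sum_basis {V : nmodType} {m n : nat} {A : 'M[int]_(m, n)} (B : basis A)
    (f : 'I_n -> V) :
  \sum_j f j = \sum_(i < m) f (idx (card_basic_set B) i)
    + \sum_(k < #|~: B|) f (idx (erefl #|~: B|) k).
Proof.
rewrite (sum_idx (card_basic_set B)) (sum_idx (erefl #|~: B|)).
rewrite (bigID (mem B)) /=; congr (_ + _); apply: eq_bigl => j.
by rewrite inE.
Qed.

Lemma dot_basis {R : realType} {m n : nat} {A : 'M[int]_(m, n)} (B : basis A)
    (c x : 'cV[R]_n) :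
  dot c x = dot (basic_part B c) (basic_part B x)
            + dot (nonbasic_part B c) (nonbasic_part B x).
Proof.
rewrite /dot !mxE (sum_basis B).
by congr (_ + _); apply: eq_bigr => i _; rewrite !mxE.
Qed.

Lemma mulmx_basis {R : realType} {m n : nat} {A : 'M[int]_(m, n)} (B : basis A)
    (x : 'cV[R]_n) :
  map_mx intr A *m x
  = basic_mx R B *m basic_part B x + nonbasic_mx R B *m nonbasic_part B x.
Proof.
apply/colP => l; rewrite !mxE (sum_basis B).
by congr (_ + _); apply: eq_bigr => i _; rewrite !mxE.
Qed.

Lemma basic_mx_unit (R : realType) {m n : nat} {A : 'M[int]_(m, n)}
    (B : basis A) :
  basic_mx R B \in unitmx.
Proof.
by rewrite unitmxE unitfE det_map_mx intr_eq0 basis_nonsingular.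
Qed.

Lemma dot_reduced_costs {R : realType} {m n : nat} {A : 'M[int]_(m, n)}
    (B : basis A) (d x : 'cV[R]_n) :
  dot d x
  = ((basic_part B d)^T *m invmx (basic_mx R B) *m (map_mx intr A *m x)) 0 0
    + dot (reduced_costs B d) (nonbasic_part B x).
Proof.
rewrite (dot_basis B) (mulmx_basis B) /dot /reduced_costs trmxK.
rewrite mulmxDr mulmxBl !mulmxA mulmxKV ?basic_mx_unit //.
move: (_ *m nonbasic_part B x) => u; rewrite !mxE; ring.
Qed.

(** The edge direction at B attached to the nonbasic index k, scaled to be
integral. *)
Lemma integral_edge {m n : nat} {A : 'M[int]_(m, n)} (B : basis A)
    (k : 'I_#|~: B|) :
  exists (h : 'cV[int]_n) (D : int),
    [/\ A *m h = 0, 0 < D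
      & rowsub (idx (erefl #|~: B|)) h = D *: delta_mx k 0].
Proof.
pose f := idx (card_basic_set B); pose g := idx (erefl #|~: B|).
pose AB := colsub f A; pose e : 'cV[int]_n := delta_mx (g k) 0.
pose D := \det AB; have D_neq0 : D != 0 := basis_nonsingular B.
(* By Cramer's rule adj(A_B) A_k is integral and A_B maps it to D A_k. The outer
   factor D makes the k-th coordinate D^2, which is positive. *)
exists (D *: (D *: e - colsub f 1%:M *m (\adj AB *m (A *m e)))), (D * D).
split; last 2 first.
- by rewrite -expr2 exprn_even_gt0.
- rewrite -scalerA; apply/colP => i.
  rewrite [LHS]mxE [LHS]mxE [RHS]mxE; congr (_ * _).
  rewrite mxE [X in X + _]mxE [X in _ + X]mxE [X in _ - X]mxE big1 ?subr0.
    by rewrite !mxE (inj_eq (@idx_inj _ _ _ _)).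
  move=> j _; rewrite !mxE -/g.
  have := idx_in (erefl #|~: B|) i; rewrite inE -/(g i).
  by case: eqP => [->|_ _]; rewrite ?mul0r // (idx_in (card_basic_set B)).
rewrite -scalemxAr mulmxBr -scalemxAr !mulmxA mulmx_colsub mulmx1 -mulmxA.
by rewrite mul_mx_adj mul_scalar_mx subrr scaler0.
Qed.

Lemma corner_reduced_costs_ge0 {R : realType} {m n : nat}
    {A : 'M[int]_(m, n)} (B : basis A) (b : 'cV[int]_m) (d x : 'cV[R]_n) :
  IFR (corner B b) x d -> nonneg (reduced_costs B d).
Proof.
move=> [/= [Ax_b x_ge0 x_int] x_opt] k.
have [h [D [Ah0 D_gt0 h_N]]] := integral_edge B k.
pose hR : 'cV[R]_n := map_mx intr h.
have AhR0 : map_mx intr A *m hR = 0 by rewrite -map_mxM Ah0 map_mx0.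
have hR_N : nonbasic_part B hR = D%:~R *: delta_mx k 0.
  by rewrite /nonbasic_part -map_mxsub h_N map_mxZ map_delta_mx.
have /x_opt : feasible (corner B b d) (x + hR).
  split.
  - by rewrite -(mulmx_basis B) mulmxDr AhR0 addr0 (mulmx_basis B).
  - move=> i; rewrite /nonbasic_part raddfD /= -!/(nonbasic_part B _) hR_N.
    rewrite [leRHS]mxE; apply: addr_ge0; first exact: x_ge0.
    by rewrite !mxE mulr_ge0 ?ler0n // ler0z ltW.
  - apply/mxOverP => i j; rewrite !mxE rpredD ?intr_int //.
    exact: (mxOverP x_int).
rewrite /= -!(dot_basis B) (dot_reduced_costs B) [leRHS](dot_reduced_costs B).
rewrite mulmxDr AhR0 addr0 lerD2l.
rewrite /nonbasic_part raddfD /= -!/(nonbasic_part B _) /dot mulmxDr hR_N.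
rewrite -scalemxAr -colE.
by rewrite [leRHS]mxE lerDl !mxE pmulr_rge0 ?ltr0z.
Qed.

Lemma IFR_LP_optimal_basis {R : realType} {m n : nat} {A : 'M[int]_(m, n)}
    {b : 'cV[int]_m} {d x : 'cV[R]_n} :
  \rank (map_mx intr A : 'M[R]_(m, n)) = m -> IFR (LP A b) x d ->
  exists B : basis A, [/\ feasible_basis R B b, nonneg (reduced_costs B d)
    & dot (reduced_costs B d) (nonbasic_part B x) = 0].
Proof.
move=> rankA [/= [Ax_b x_ge0] x_opt].
have [|S [x' [y [[indS spanS] [x'_ge0 Ax' x'0] [s_ge0 s_x] s_S]]]] :=
  optimal_basic_set (d := d) rankA x_ge0.
  by move=> x' x'_ge0 Ax'; apply: x_opt; split; rewrite // Ax'.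
have cardS : #|S| = m.
  by rewrite -(independent_rank (erefl _) indS) (spanning_rank _ spanS).
have detS : \det (colsub (idx cardS) A) != 0.
  rewrite -(intr_eq0 R) -det_map_mx -unitfE -unitmxE -row_free_unit.
  by rewrite /row_free map_mxsub (spanning_rank cardS spanS).
pose B := Basis detS; exists B.
have AB_x' : basic_mx R B *m basic_part B x' = map_mx intr b.
  rewrite -Ax_b -Ax' -(mulmx_colsub_idx _ cardS x' x'0).
  by rewrite /basic_mx map_mxsub.
(* Tightness on B determines y: it is the vector of simplex multipliers of B. *)
have y_B : y^T *m basic_mx R B = (basic_part B d)^T.
  apply: trmx_inj; rewrite trmx_mul !trmxK; apply/colP => i.
  have := s_S _ (idx_in cardS i); rewrite !mxE => /eqP.
  rewrite subr_eq0 => /eqP->; apply: eq_bigr => j _.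
  by rewrite !mxE.
have costsE : reduced_costs B d = nonbasic_part B (dual_slack (map_mx intr A) d y).
  rewrite /reduced_costs -y_B mulmxK ?basic_mx_unit //.
  rewrite linearB /= trmxK trmx_mul trmxK /dual_slack /nonbasic_part.
  rewrite [RHS]linearB /=; congr (_ - _); apply/colP => i; rewrite !mxE.
  by apply: eq_bigr => j _; rewrite !mxE.
split.
- by rewrite /feasible_basis -AB_x' mulKmx ?basic_mx_unit // => i; rewrite mxE.
- by move=> i; rewrite costsE mxE.
rewrite costsE /dot mxE big1 // => i _; rewrite !mxE -/(idx _ _).
set j := idx _ _; have [->|xj_neq0] := eqVneq (x j 0) 0; first by rewrite mulr0.
by have := s_x j xj_neq0; rewrite !mxE => ->; rewrite mul0r.
Qed.

Theorem theorem1 (R : realType) (m n : nat) (lemn : (m <= n)%N)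
    (A : 'M[int]_(m, n)) (rankA : \rank (map_mx intr A : 'M[R]_(m, n)) = m)
    (b : 'cV[int]_m) (c : 'cV[R]_n)
    (x0 : 'cV[R]_n) (x0_feasible : feasible (IP A b c) x0) :
  IFR (LP A b) x0 =
  [set d | exists B : basis A,
     [/\ feasible_basis R B b,
         IFR (corner B b) x0 d
       & dot (reduced_costs B d) (nonbasic_part B x0) = 0]].
Proof.
case: x0_feasible => Ax0 x0_ge0 x0_int; apply/seteqP; split=> d /=.
  move=> /(IFR_LP_optimal_basis rankA)[B [B_feas costs_ge0 costs_x0]].
  exists B; split=> //; split=> /=.
    by split=> //; [rewrite -(mulmx_basis B) | move=> i; rewrite mxE].
  move=> x [Ax x_ge0 _]; rewrite -!(dot_basis B) !(dot_reduced_costs B).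
  rewrite Ax0 (mulmx_basis B x) Ax costs_x0 lerD2l.
  by rewrite /dot mxE sumr_ge0 // => i _; rewrite mxE mulr_ge0.
move=> [B [_ /corner_reduced_costs_ge0 costs_ge0 costs_x0]]; split=> //= x.
move=> [Ax x_ge0]; rewrite !(dot_reduced_costs B) Ax0 Ax costs_x0 lerD2l.
rewrite /dot mxE sumr_ge0 // => i _; rewrite mxE mulr_ge0 //.
by rewrite mxE.
Qed.
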